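(* Let $k$ be a positive integer and let $T = \{-k,\ldots,k\}\setminus\{0\} \subset \mathbb{Z}$ be the punctured interval. Then $T$ tiles $\mathbb{Z}^4$. Furthermore, if $k$ is odd or $k \equiv 4 \pmod 8$, then $T$ tiles $\mathbb{Z}^3$.
   Context: A tile is a finite non-empty subset of $\mathbb{Z}^n$ for some $n$. A tile $T \subset \mathbb{Z}^n$ is also regarded as a tile in $\mathbb{Z}^d$ for any $d \ge n$, via $T \times \{0\}^{d-n} \subset \mathbb{Z}^d$. A copy of $T$ in $\mathbb{Z}^d$ is a subset of $\mathbb{Z}^d$ obtained from $T$ by translations, rotations or reflections of $\mathbb{Z}^d$, or any combination of these. (For $T = \{-k,\ldots,k\}\setminus\{0\}\subset\mathbb{Z}$, the copies of $T$ in $\mathbb{Z}^d$ are exactly the sets $\{v + t e_j : t \in T\}$ with $v \in \mathbb{Z}^d$ and $e_j$ a standard basis vector.) $T$ tiles $\mathbb{Z}^d$ if $\mathbb{Z}^d$ can be partitioned into copies of $T$. *)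

(* Defs.v *)
From mathcomp Require Import all_boot all_order all_algebra.
From mathcomp Require Import all_classical.

Set Implicit Arguments.
Unset Strict Implicit.
Unset Printing Implicit Defensive.

Import Order.TTheory GRing.Theory Num.Theory.

Local Open Scope classical_set_scope.
Local Open Scope ring_scope.

Definition is_tile (n : nat) (T : set 'rV[int]_n) : Prop :=
  finite_set T /\ T !=set0.

(* Pads with zero coordinates; used for n <= d only (it truncates if d < n). *)
Definition embed_pt (n d : nat) (t : 'rV[int]_n) : 'rV[int]_d :=
  \row_(i < d) oapp (fun j : 'I_n => t 0 j) 0 (insub (val i)).

(* The rotations and reflections of Z^d fixing the origin, and their
   composites, are the maps x |-> x A with A an integer orthogonal matrix
   (equivalently, a signed permutation matrix). *)
Definition is_copy (n d : nat) (T : set 'rV[int]_n) (S : set 'rV[int]_d)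
    : Prop :=
  exists (A : 'M[int]_d) (v : 'rV[int]_d),
    A *m A^T = 1%:M /\ S = [set embed_pt d t *m A + v | t in T].

Definition tiles (n d : nat) (T : set 'rV[int]_n) : Prop :=
  (n <= d)%N /\
  exists2 C : set (set 'rV[int]_d),
    (forall S, C S -> is_copy T S) & partition C id [set: 'rV[int]_d].

Definition punctured_interval (k : nat) : set 'rV[int]_1 :=
  [set x | (- k%:Z <= x 0 0 <= k%:Z) && (x 0 0 != 0)].

Lemma punctured_interval_tile (k : nat) :
  (0 < k)%N -> is_tile (punctured_interval k).
Proof.
move=> k0; split; last first.
  exists (const_mx 1); rewrite /punctured_interval /= !mxE /=.
  by rewrite lez_nat k0 andbT (le_trans _ (ler01 : 0 <= 1 :> int)) // oppr_le0.
pose f (i : nat) : 'rV[int]_1 := const_mx (i%:Z - k%:Z).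
apply: (@sub_finite_set _ _ (f @` `I_(k + k).+1)); last first.
  exact/finite_image/finite_II.
move=> x /= /andP[/andP[h1 h2] _].
have h3 : 0 <= x 0 0 + k%:Z by rewrite -lerBlDr sub0r.
exists `|(x 0 0 + k%:Z)%R|%N.
  by rewrite /= ltnS -lez_nat gez0_abs // PoszD lerD2r.
apply/rowP => i; rewrite (ord1 i) /f mxE gez0_abs // addrK; by [].
Qed.

(* Main.v *)
Require Import Defs.
From mathcomp Require Import all_boot all_order all_algebra all_fingroup.
From mathcomp Require Import all_classical.
From mathcomp Require Import zify.

(* Only three coordinates x, y, t are used, the others being carried along.
   Suppose that P, Q, R are sets of points (x, y), each tiled by copies of T,
   such that every point lies in one or in three of them. Stack over every point
   lying in exactly one of them a column of copies of T in direction t, with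
   lowest cells at 2k, k, 0 mod 3k for P, Q, R respectively. At each height
   exactly one of the three classes of columns is absent, and the layer at
   this height minus the columns that are present is the corresponding one of
   P, Q, R, which is tiled within the layer.

   To find P, Q, R, put m = k + 1. The line minus a coset of mZ is tiled by T,
   so we may let P be the complement of E = {(x, y) : x = floor(y/k) mod m}.
   Each column {y : (x, y) in E} consists of intervals of length k, consecutive
   ones being at distance km; pair them up. A chain of k copies of T, each
   shifted by m from the previous one, covers the two intervals of a pair once,
   and all other points an even number of times. Let Q and R be the unions of
   the copies with even and odd index: E is their symmetric difference. *)

Set Implicit Arguments.
Unset Strict Implicit.
Unset Printing Implicit Defensive.

Import Order.TTheory GRing.Theory Num.Theory.

Local Open Scope classical_set_scope.
Local Open Scope ring_scope.

(** * Bars along a line *)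

Lemma small_multiple (n N : int) : - N < n * N < N -> n = 0.
Proof. nia. Qed.

Lemma modz_unique (q r d : int) : 0 <= r < d -> ((q * d + r) %% d)%Z = r.
Proof. by move=> rd; rewrite modzMDl modz_small //; lia. Qed.

Definition covered (K : int) (D : int -> Prop) (z : int) : Prop :=
  exists2 c, D c & 0 < `|z - c| <= K.

(** Two bars on a line can meet only if their centres are at distance at most [2 * K]. *)
Definition spaced (K : int) (D : int -> Prop) : Prop :=
  forall c c', D c -> D c' -> `|c - c'| <= 2 * K -> c = c'.

Lemma spaced_progression (K a N : int) :
  2 * K < N -> spaced K (fun c => exists n, c = a + n * N).
Proof.
move=> KN c c' [n ->] [n' ->] h.
suff -> : n = n' by [].
suff : n - n' = 0 by lia.
apply: (@small_multiple _ N); lia.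
Qed.

(** At period [2 * (K + 1)] the bars leave out exactly their centres and the midpoints between
    consecutive centres. *)
Lemma covered_string (K h z : int) : 0 < K ->
  covered K (fun c => exists n, c = h + n * (2 * (K + 1))) z <->
  ~~ (K + 1 %| z - h)%Z.
Proof.
move=> K0; split=> [[c [n ->] zc]|].
  apply/negP => /dvdzP[q hq].
  suff : q - 2 * n = 0 by nia.
  apply: (@small_multiple _ (K + 1)); lia.
move=> ndvd.
have := divz_eq (z - h) (2 * (K + 1)).
set q := (_ %/ _)%Z; set r := (_ %% _)%Z => zh.
have r0 : 0 <= r by apply: modz_ge0; lia.
have r1 : r < 2 * (K + 1) by apply: ltz_pmod; lia.
have rn0 : r != 0.
  apply: contra ndvd => /eqP r_0; apply/dvdzP; exists (2 * q); lia.
have rnK : r != K + 1.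
  apply: contra ndvd => /eqP r_K; apply/dvdzP; exists (2 * q + 1); lia.
have [rK|Kr] := leP r K.
  by exists (h + q * (2 * (K + 1))); [exists q | lia].
exists (h + (q + 1) * (2 * (K + 1))); [by exists (q + 1) | lia].
Qed.

(** * Columns of period 3k in direction t *)

Definition active (K u : int) : bool :=
  let r := (u %% (3 * K))%Z in (r <= 2 * K) && (r != K).

Lemma covered_active (K a z : int) : 0 < K ->
  covered K (fun c => exists n, c = a + K + n * (3 * K)) z <->
  active K (z - a).
Proof.
move=> K0; split=> [[c [n ->] zc]|].
  rewrite /active (_ : z - a = n * (3 * K) + (z - a - n * (3 * K))); last by lia.
  rewrite modz_unique; lia.
rewrite /active; have := divz_eq (z - a) (3 * K).
have := @modz_ge0 (z - a) (3 * K); have := @ltz_pmod (z - a) (3 * K).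
set q := (_ %/ _)%Z; set r := (_ %% _)%Z => h1 h2 zh /andP[h3 h4].
by exists (a + K + q * (3 * K)); [exists q | lia].
Qed.

(* Among the residues mod [3 * K], a column is inactive at [K] and at
   [2 * K + 1, ..., 3 * K - 1]; the translates of this set by [0], [K] and
   [2 * K] partition [Z / 3 * K]. *)
Lemma one_inactive (K t : int) : 0 < K ->
  [\/ [/\ active K t, active K (t - K) & ~~ active K (t - 2 * K)],
      [/\ active K t, ~~ active K (t - K) & active K (t - 2 * K)] |
      [/\ ~~ active K t, active K (t - K) & active K (t - 2 * K)]].
Proof.
move=> K0.
have := divz_eq t (3 * K).
have := @modz_ge0 t (3 * K); have := @ltz_pmod t (3 * K).
rewrite /active.
set q := (_ %/ _)%Z; set r := (_ %% _)%Z => h1 h2 zh.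
have shift (s : int) : 0 <= s < 3 * K ->
    ((t - s) %% (3 * K))%Z = if s <= r then r - s else r - s + 3 * K.
  move=> s0; case: leP => sr.
    by rewrite (_ : t - s = q * (3 * K) + (r - s)) ?modz_unique; lia.
  by rewrite (_ : t - s = (q - 1) * (3 * K) + (r - s + 3 * K)) ?modz_unique; lia.
rewrite !shift; try lia.
case: (leP K r) => ?; case: (leP (2 * K) r) => ?; try lia.
- by have [?|?] := eqVneq r (2 * K); [apply: Or32|apply: Or33]; split; lia.
- by have [?|?] := eqVneq r K; [apply: Or33|apply: Or31]; split; lia.
- by have [?|?] := eqVneq r 0; [apply: Or31|apply: Or32]; split; lia.
Qed.

(** * The chains of bars forming Q and R *)

(* Bars starting at [0], [K + 1], [2 * (K + 1)], ..., [(K - 1) * (K + 1)] cover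
   [[0, K)] and [[K * (K + 1), K * (K + 1) + K)] once and everything else twice
   or not at all; consecutive bars overlap, so they are split by parity. *)
Definition lower (K s : int) : bool := (s %% (2 * K))%Z < K.

(** Cut the line into blocks of length [K + 1]. Block [a] without its last cell is both the lower
    half of bar [a] and the upper half of bar [a - 1]; this selects the one whose index has the
    parity of [e]. *)
Definition same_parity (e a : int) : int := if (2 %| a - e)%Z then a else a - 1.

Definition col_start (K e w : int) : Prop :=
  exists s, [/\ w = s * (K + 1), (2 %| s - e)%Z & lower K s].

Definition col_covered (K e w : int) : bool :=
  ((w %% (K + 1))%Z < K) && lower K (same_parity e (w %/ (K + 1))%Z).

(** Indices of equal parity put the bars at distances divisible by [2 * (K + 1)]. *)
Lemma spaced_col (K e a : int) : 0 < K -> spaced K (fun c => col_start K e (c - a)).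
Proof.
move=> K0 c c' [s [cs se _]] [s' [cs' se' _]] h.
have [q hq] := dvdzP se; have [q' hq'] := dvdzP se'.
suff : q - q' = 0 by nia.
apply: (@small_multiple _ (2 * (K + 1))).
have -> : (q - q') * (2 * (K + 1)) = c - c'.
  have -> : c - c' = (s - s') * (K + 1) by lia.
  have -> : s - s' = (q - q') * 2 by lia.
  lia.
lia.
Qed.

Lemma covered_col (K e a z : int) : 0 < K ->
  covered K (fun c => col_start K e (c - (a + K))) z <-> col_covered K e (z - a).
Proof.
move=> K0; rewrite /col_covered.
split=> [[c [s [cs se ls]] zc]|].
  (* The lower half of bar [s] lies in block [s], the upper half in block [s + 1]. *)
  have [zc0|zc0] := ltP z c.
    have -> : z - a = s * (K + 1) + (z - c + K) by lia.
    rewrite modz_unique ?divzMDl ?(@divz_small (z - c + K)); try lia.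
    by rewrite addr0 /same_parity se ls andbT; lia.
  have -> : z - a = (s + 1) * (K + 1) + (z - c - 1) by lia.
  rewrite modz_unique ?divzMDl ?(@divz_small (z - c - 1)); try lia.
  by rewrite addr0 /same_parity ifF ?addrK ?ls ?andbT; lia.
have := divz_eq (z - a) (K + 1).
have := @modz_ge0 (z - a) (K + 1); have := @ltz_pmod (z - a) (K + 1).
set q := (_ %/ _)%Z; set r := (_ %% _)%Z => h1 h2 zh /andP[rK].
rewrite /same_parity; case: ifPn => par low.
  exists (a + K + q * (K + 1)); last by lia.
  by exists q; split => //; lia.
exists (a + K + (q - 1) * (K + 1)); last by lia.
by exists (q - 1); split => //; lia.
Qed.

Lemma lower_jump (K s : int) : 0 < K ->
  (lower K s (+) lower K (s - 1)) = (K %| s)%Z.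
Proof.
move=> K0; rewrite /lower.
have := divz_eq s (2 * K).
have := @modz_ge0 s (2 * K); have := @ltz_pmod s (2 * K).
set q := (_ %/ _)%Z; set r := (_ %% _)%Z => h1 h2 sq.
have -> : ((s - 1) %% (2 * K))%Z = if r == 0 then 2 * K - 1 else r - 1.
  case: eqP => r0.
    by rewrite (_ : s - 1 = (q - 1) * (2 * K) + (2 * K - 1)) ?modz_unique; lia.
  by rewrite (_ : s - 1 = q * (2 * K) + (r - 1)) ?modz_unique; lia.
apply/idP/idP.
  move=> h; have [r0|rK] : r = 0 \/ r = K.
  - by move: h; case: eqP; case: ltP; case: ltP; lia.
  - by apply/dvdzP; exists (2 * q); lia.
  - by apply/dvdzP; exists (2 * q + 1); lia.
move=> /dvdzP[j hj].
have [r0|rn0] := eqVneq r 0; first by case: ltP; case: ltP; lia.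
suff -> : r = K by case: ltP; case: ltP; lia.
suff : j - 2 * q - 1 = 0 by nia.
by apply: (@small_multiple _ K); lia.
Qed.

(** The two bars over block [q] have opposite parities, so by [lower_jump] exactly one is present
    iff [K] divides [q]. If [q = n * K], then [y = (x + n * (K + 1)) * K + r], whence the quotient
    of [y] by [K]. *)
Lemma col_covered_parity (K x y : int) : 0 < K ->
  (col_covered K 0 (y - x * K) (+) col_covered K 1 (y - x * K)) =
  (K + 1 %| x - (y %/ K)%Z)%Z.
Proof.
move=> K0; rewrite /col_covered.
set w := y - x * K; have := divz_eq w (K + 1).
have := @modz_ge0 w (K + 1); have := @ltz_pmod w (K + 1).
set q := (w %/ _)%Z; set r := (w %% _)%Z => h1 h2 wq.
have -> : (r < K) && lower K (same_parity 0 q) (+)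
          (r < K) && lower K (same_parity 1 q) = (r < K) && (K %| q)%Z.
  case: (r < K) => //=; rewrite -lower_jump // /same_parity.
  have -> : (2 %| q - 1)%Z = ~~ (2 %| q - 0)%Z by lia.
  by case: (2 %| q - 0)%Z; rewrite // addbC.
have := divz_eq y K; have := @modz_ge0 y K; have := @ltz_pmod y K.
set q' := (y %/ _)%Z; set r' := (y %% _)%Z => h1' h2' yq.
apply/idP/idP.
  case/andP=> rK /dvdzP[n qn].
  apply/dvdzP; exists (- n).
  suff : q' - (x + n * (K + 1)) = 0 by lia.
  apply: (@small_multiple _ K); rewrite /w in wq; nia.
move=> /dvdzP[n xn].
have wn : w = (- n * K) * (K + 1) + r' by rewrite /w; nia.
have rr' : r = r' by rewrite /r wn modz_unique; lia.
have -> : q = - n * K.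
  suff : q - (- n * K) = 0 by lia.
  apply: (@small_multiple _ (K + 1)); lia.
by rewrite rr' dvdz_mull // andbT; lia.
Qed.

(** * From lines to the whole space *)

Definition bar (d : nat) (K : int) (j : 'I_d) (v : 'rV[int]_d) : set 'rV[int]_d :=
  [set v + t *: delta_mx 0 j | t in [set t : int | 0 < `|t| <= K]].

Lemma bar_is_copy (n k : nat) (j : 'I_n.+1) (v : 'rV[int]_n.+1) :
  is_copy (punctured_interval k) (bar k%:Z j v).
Proof.
exists (tperm_mx ord0 j), v; split.
  by rewrite tr_tperm_mx -perm_mxM tperm2 perm_mx1.
have embedE (t : 'rV[int]_1) :
    embed_pt n.+1 t *m tperm_mx ord0 j + v = v + t 0 0 *: delta_mx 0 j.
  rewrite addrC; congr (_ + _).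
  have -> : embed_pt n.+1 t = t 0 0 *: delta_mx 0 ord0.
    apply/rowP => i; rewrite !mxE eqxx /=.
    have [->|i0] := eqVneq i ord0.
      by rewrite insubT /= mulr1; congr (t _ _); apply/val_inj.
    by rewrite insubF ?mulr0 //= ltnS leqn0; apply/negbTE.
  rewrite -scalemxAl -rowE; congr (_ *: _).
  by apply/rowP => i; rewrite !mxE tpermL eqxx eq_sym.
apply/seteqP; split => _ [t /= tk <-].
  exists (const_mx t); last by rewrite embedE mxE.
  by rewrite /punctured_interval /= mxE; lia.
by exists (t 0 0); [move: tk; rewrite /punctured_interval /=; lia | rewrite embedE].
Qed.

Definition set_coord (d : nat) (p : 'rV[int]_d) (j : 'I_d) (c : int) : 'rV[int]_d :=
  \row_i if i == j then c else p 0 i.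

Lemma bar_set_coord (d : nat) (K : int) (j : 'I_d) (v p : 'rV[int]_d) :
  bar K j v p <-> 0 < `|p 0 j - v 0 j| <= K /\ v = set_coord p j (v 0 j).
Proof.
split=> [[t /= tK <-]|[pv vE]].
  split; first by rewrite !mxE !eqxx mulr1 addrAC subrr add0r.
  apply/rowP => i; rewrite !mxE eqxx /=.
  by have [->|ij] := eqVneq i j; rewrite // mulr0 addr0.
exists (p 0 j - v 0 j) => //.
apply/rowP => i; rewrite vE !mxE !eqxx /=.
by have [->|ij] := eqVneq i j; lia.
Qed.

Lemma tiles_centres (n k : nat) (C : 'I_n.+1 -> 'rV[int]_n.+1 -> Prop) :
    (0 < k)%N ->
    (forall p, exists j, covered k%:Z (fun c => C j (set_coord p j c)) (p 0 j)) ->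
    (forall p j j', covered k%:Z (fun c => C j (set_coord p j c)) (p 0 j) ->
       covered k%:Z (fun c => C j' (set_coord p j' c)) (p 0 j') -> j = j') ->
    (forall p j, spaced k%:Z (fun c => C j (set_coord p j c))) ->
  tiles n.+1 (punctured_interval k).
Proof.
move=> k0 Ccov Cdir Csp; split=> //.
exists [set S | exists j v, C j v /\ S = bar k%:Z j v].
  by move=> _ [j [v [_ ->]]]; exact: bar_is_copy.
split.
- apply/seteqP; split => // p _.
  have [j [c Cc pc]] := Ccov p.
  exists (bar k%:Z j (set_coord p j c)); first by exists j, (set_coord p j c).
  by apply/bar_set_coord; rewrite mxE eqxx.
- move=> _ _ [j [v [Cv ->]]] [j' [v' [Cv' ->]]] [p [/bar_set_coord[pv vE]]].
  move=> /bar_set_coord[pv' vE'].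
  rewrite vE in Cv; rewrite vE' in Cv'.
  have jj' : j = j' by apply: (Cdir p); [exists (v 0 j) | exists (v' 0 j')].
  move: Cv' pv' vE'; rewrite -jj' => Cv' pv' vE'.
  have vv' : v 0 j = v' 0 j by apply: (Csp p j) => //; lia.
  by rewrite vE vE' vv'.
- move=> _ [j [v [_ ->]]]; exists (v + 1 *: delta_mx 0 j).
  by exists 1 => //=; lia.
Qed.

(* Here [w = y - x * K], [P] is the complement of the exclusive or of
   [Q := col_covered K 0] and [R := col_covered K 1], and [post_start] encodes
   the three classes of points lying in exactly one of [P], [Q], [R]. *)
Definition post_start (K w : int) : option int :=
  match col_covered K 0 w, col_covered K 1 w with
  | false, false => Some (2 * K)
  | true, false => Some K
  | false, true => Some 0
  | true, true => None
  end.

Definition centre (K : int) (j : nat) (x y t : int) : Prop :=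
  match j with
  | 0%N => ~~ active K (t - 2 * K) /\
           exists n, x = (y %/ K)%Z + n * (2 * (K + 1))
  | 1%N => ~~ active K (t - K) /\ col_start K 0 (y - (x * K + K)) \/
           ~~ active K t /\ col_start K 1 (y - (x * K + K))
  | 2%N => exists2 a, post_start K (y - x * K) = Some a &
           exists n, t = a + K + n * (3 * K)
  | _ => False
  end.

Lemma covered_ext (K : int) (D D' : int -> Prop) (z : int) :
  (forall c, D c <-> D' c) -> covered K D z <-> covered K D' z.
Proof. by move=> DD'; split=> -[c /DD' Dc zc]; exists c. Qed.

Lemma covered_and (K : int) (b : bool) (D : int -> Prop) (z : int) :
  covered K (fun c => b /\ D c) z <-> b /\ covered K D z.
Proof. by split=> [[c [? ?] ?]|[? [c ? ?]]]; [split=> //; exists c|exists c]. Qed.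

Lemma covered_or (K : int) (D D' : int -> Prop) (z : int) :
  covered K (fun c => D c \/ D' c) z <-> covered K D z \/ covered K D' z.
Proof.
split=> [[c [?|?] ?]|[[c ? ?]|[c ? ?]]].
- by left; exists c.
- by right; exists c.
- by exists c => //; left.
- by exists c => //; right.
Qed.

Lemma covered_centre_x (K x y t : int) : 0 < K ->
  covered K (fun c => centre K 0 c y t) x <->
  ~~ active K (t - 2 * K) &&
  ~~ (col_covered K 0 (y - x * K) (+) col_covered K 1 (y - x * K)).
Proof.
move=> K0; rewrite /centre covered_and covered_string // -col_covered_parity //.
by split=> [[-> ->]|/andP].
Qed.

Lemma covered_centre_y (K x y t : int) : 0 < K ->
  covered K (fun c => centre K 1 x c t) y <->
  (~~ active K (t - K) && col_covered K 0 (y - x * K)) ||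
  (~~ active K t && col_covered K 1 (y - x * K)).
Proof.
move=> K0; rewrite /centre covered_or !covered_and !covered_col //.
split=> [[[-> ->]|[-> ->]]|/orP[/andP|/andP]]; rewrite ?orbT //; by [left|right].
Qed.

Lemma covered_centre_t (K x y t : int) : 0 < K ->
  let Q := col_covered K 0 (y - x * K) in
  let R := col_covered K 1 (y - x * K) in
  covered K (fun c => centre K 2 x y c) t <->
  [|| [&& ~~ Q, ~~ R & active K (t - 2 * K)], [&& Q, ~~ R & active K (t - K)]
    | [&& ~~ Q, R & active K t]].
Proof.
move=> K0; rewrite /centre /post_start.
case: (col_covered K 0 _); case: (col_covered K 1 _) => /=; rewrite ?orbF.
- by split=> // -[c []].
- rewrite -(@covered_active K K) //; apply: covered_ext => c.
  by split=> [[_ [<-]]|]; last exists K.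
- rewrite -[t in active K t]subr0 -(@covered_active K 0) //; apply: covered_ext => c.
  by split=> [[_ [<-]]|]; last exists 0.
- rewrite -(@covered_active K (2 * K)) //; apply: covered_ext => c.
  by split=> [[_ [<-]]|]; last exists (2 * K).
Qed.

Lemma punctured_interval_tiles (n k : nat) :
  (0 < k)%N -> tiles n.+3 (punctured_interval k).
Proof.
move=> k0; have K0 : 0 < k%:Z by lia.
pose i0 : 'I_n.+3 := Ordinal (isT : 0 < n.+3)%N.
pose i1 : 'I_n.+3 := Ordinal (isT : 1 < n.+3)%N.
pose i2 : 'I_n.+3 := Ordinal (isT : 2 < n.+3)%N.
pose C (j : 'I_n.+3) (v : 'rV[int]_n.+3) :=
  centre k%:Z j (v 0 i0) (v 0 i1) (v 0 i2).
have ordP j : [\/ j = i0, j = i1, j = i2 | (2 < j)%N].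
  case: j => -[|[|[|j]]] lt_j; [apply: Or41|apply: Or42|apply: Or43|exact: Or44];
    exact: val_inj.
have C0 p c : C i0 (set_coord p i0 c) = centre k%:Z 0 c (p 0 i1) (p 0 i2).
  by rewrite /C !mxE.
have C1 p c : C i1 (set_coord p i1 c) = centre k%:Z 1 (p 0 i0) c (p 0 i2).
  by rewrite /C !mxE.
have C2 p c : C i2 (set_coord p i2 c) = centre k%:Z 2 (p 0 i0) (p 0 i1) c.
  by rewrite /C !mxE.
have Cn (j : 'I_n.+3) v : (2 < j)%N -> ~ C j v.
  by rewrite /C; case: j => -[|[|[|j]]] lt_j //= _ [].
pose cov p j := covered k%:Z (fun c => C j (set_coord p j c)) (p 0 j).
pose Q (p : 'rV[int]_n.+3) := col_covered k%:Z 0 (p 0 i1 - p 0 i0 * k%:Z).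
pose R (p : 'rV[int]_n.+3) := col_covered k%:Z 1 (p 0 i1 - p 0 i0 * k%:Z).
pose a (s : int) (p : 'rV[int]_n.+3) := active k%:Z (p 0 i2 - s).
have cov0 p : cov p i0 <-> ~~ a (2 * k%:Z) p && ~~ (Q p (+) R p).
  by rewrite -covered_centre_x //; apply: covered_ext => c; rewrite C0.
have cov1 p : cov p i1 <-> (~~ a k%:Z p && Q p) || (~~ active k%:Z (p 0 i2) && R p).
  by rewrite -covered_centre_y //; apply: covered_ext => c; rewrite C1.
have cov2 p : cov p i2 <-> [|| [&& ~~ Q p, ~~ R p & a (2 * k%:Z) p],
    [&& Q p, ~~ R p & a k%:Z p] | [&& ~~ Q p, R p & active k%:Z (p 0 i2)]].
  by rewrite -covered_centre_t //; apply: covered_ext => c; rewrite C2.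
have covn p (j : 'I_n.+3) : (2 < j)%N -> ~ cov p j by move=> j2 [c /(Cn _ _ j2)].
apply: (@tiles_centres _ _ C) => //.
- move=> p; suff : [\/ cov p i0, cov p i1 | cov p i2] by case; eexists; eassumption.
  have := one_inactive (p 0 i2) K0; rewrite -/(a k%:Z p) -/(a (2 * k%:Z) p).
  have := cov0 p; have := cov1 p; have := cov2 p.
  case: (Q p); case: (R p); case: (a _ p); case: (a _ p); case: (active _ _) => /=;
    by move=> [_ c2] [_ c1] [_ c0] [] [] // _ _ _;
       (try by apply: Or31; apply: c0); (try by apply: Or32; apply: c1);
       apply: Or33; apply: c2.
- move=> p j j'; rewrite -/(cov p j) -/(cov p j').
  have := one_inactive (p 0 i2) K0; rewrite -/(a k%:Z p) -/(a (2 * k%:Z) p).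
  case: (ordP j) => [->|->|->|j2]; last (by move=> _ /(covn _ _ j2));
    case: (ordP j') => [->|->|->|j2']; try (by move=> _ _ /(covn _ _ j2'));
    rewrite // ?cov0 ?cov1 ?cov2;
    case: (Q p); case: (R p); case: (a _ p); case: (a _ p); case: (active _ _) => //=;
    by move=> [] [].
move=> p j c c'.
have [->|->|->|j2] := ordP j; last by move=> /(Cn _ _ j2).
- rewrite !C0 => -[_ h] [_ h']; apply: spaced_progression h h'; lia.
- rewrite !C1.
  have := one_inactive (p 0 i2) K0.
  move=> inact [[a1 h]|[a1 h]] [[a2 h']|[a2 h']];
    try exact: (spaced_col K0 h h'); move: inact a1 a2;
    by case: (active _ _); case: (active _ _); case: (active _ _) => //= -[] [].
- rewrite !C2 => -[s hs h] [s']; rewrite hs => -[<-] h'.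
  apply: spaced_progression h h'; lia.
Qed.

Theorem theorem2 (k : nat) (hk : (0 < k)%N) :
  tiles 4 (punctured_interval k) /\
  ((odd k \/ (k = 4 %[mod 8])%N) -> tiles 3 (punctured_interval k)).
Proof. by split=> [|_]; apply: punctured_interval_tiles. Qed.
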